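(* For each integer $k>0$ let $M_k$ be the structure $\langle\mathbb{R},<,B,P\rangle$ where $B(t,s)$ holds iff $s=t+1$ and $P=\{m/k : m\in\mathbb{Z}\}$. Every formula $\varphi(t_0)$ of second-order monadic logic of order in the vocabulary $\{<,B,P\}$ with exactly one free first-order variable $t_0$ and no free predicate variables is, in every model $M_k$, equivalent to one of the four formulas $\mathit{True}$, $\mathit{False}$, $P(t_0)$, $\neg P(t_0)$; that is, the set $\{t\in\mathbb{R}: M_k\models\varphi[t]\}$ is one of $\mathbb{R}$, $\emptyset$, $P$, $\mathbb{R}\setminus P$.
   Context: Second-order monadic logic of order in vocabulary $\{<,B,P\}$: atomic formulas $t_1<t_2$, $t_1=t_2$, $B(t_1,t_2)$, $P(t)$, $X(t)$ for first-order variables $t,t_i$ and monadic predicate variables $X$; formulas are closed under Boolean connectives, first-order quantifiers and monadic second-order quantifiers (over arbitrary subsets of $\mathbb{R}$). Which of the four formulas applies may depend on $k$. *)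

(* Defs.v *)
From mathcomp Require Import all_boot all_order all_algebra.
From mathcomp Require Import all_classical reals.

Set Implicit Arguments.
Unset Strict Implicit.
Unset Printing Implicit Defensive.

Local Open Scope classical_set_scope.

(* First-order and monadic predicate variables are two separate sorts, each
   named by natural numbers; a name may be quantified repeatedly and may occur
   both free and bound. *)
Inductive formula : Type :=
| FLt of nat & nat
| FEq of nat & nat
| FB of nat & nat
| FP of nat
| FMem of nat & nat              (* FMem X t is X(t) *)
| FTrue
| FFalse
| FNot of formula
| FAnd of formula & formula
| FOr of formula & formula
| FImp of formula & formula
| FAll1 of nat & formula
| FEx1 of nat & formula
| FAll2 of nat & formula
| FEx2 of nat & formula.

Fixpoint free1 (f : formula) : seq nat :=
  match f with
  | FLt t s | FEq t s | FB t s => [:: t; s]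
  | FP t | FMem _ t => [:: t]
  | FTrue | FFalse => [::]
  | FNot g => free1 g
  | FAnd g h | FOr g h | FImp g h => free1 g ++ free1 h
  | FAll1 t g | FEx1 t g => [seq s <- free1 g | s != t]
  | FAll2 _ g | FEx2 _ g => free1 g
  end.

Fixpoint free2 (f : formula) : seq nat :=
  match f with
  | FLt _ _ | FEq _ _ | FB _ _ | FP _ | FTrue | FFalse => [::]
  | FMem X _ => [:: X]
  | FNot g => free2 g
  | FAnd g h | FOr g h | FImp g h => free2 g ++ free2 h
  | FAll1 _ g | FEx1 _ g => free2 g
  | FAll2 X g | FEx2 X g => [seq Y <- free2 g | Y != X]
  end.

Record structure : Type := Structure {
  carrier :> Type;
  ltI : carrier -> carrier -> Prop;
  BI : carrier -> carrier -> Prop;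
  PI : set carrier
}.

Definition upd (T : Type) (e : nat -> T) (x : nat) (a : T) : nat -> T :=
  fun y => if y == x then a else e y.

Fixpoint sat (M : structure) (e : nat -> M) (E : nat -> set M)
    (f : formula) : Prop :=
  match f with
  | FLt t s => ltI (e t) (e s)
  | FEq t s => e t = e s
  | FB t s => BI (e t) (e s)
  | FP t => PI (e t)
  | FMem X t => E X (e t)
  | FTrue => True
  | FFalse => False
  | FNot g => ~ sat e E g
  | FAnd g h => sat e E g /\ sat e E h
  | FOr g h => sat e E g \/ sat e E h
  | FImp g h => sat e E g -> sat e E h
  | FAll1 t g => forall a : M, sat (upd e t a) E g
  | FEx1 t g => exists a : M, sat (upd e t a) E g
  | FAll2 X g => forall A : set M, sat e (upd E X A) g
  | FEx2 X g => exists A : set M, sat e (upd E X A) g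
  end.

Definition equiv_in (M : structure) (f g : formula) : Prop :=
  forall (e : nat -> M) (E : nat -> set M), sat e E f <-> sat e E g.

(* The set of t with M |= f[t], where t is the value of the variable t0.  It is
   meant for f with no free variable other than t0, for which satisfaction
   does not depend on the rest of the assignment (e, E). *)
Definition truth_set (M : structure) (f : formula) (t0 : nat) : set M :=
  [set t | forall (e : nat -> M) (E : nat -> set M), sat (upd e t0 t) E f].
Arguments truth_set M f t0 : clear implicits.

Local Open Scope ring_scope.

Definition Pset (R : realType) (k : int) : set R :=
  [set t | exists m : int, t = m%:~R / k%:~R].
Arguments Pset R k : clear implicits.

Definition Mk (R : realType) (k : int) : structure :=
  @Structure R (fun t s => t < s) (fun t s => s = t + 1) (Pset R k).

(* Main.v *)
(* Automorphisms of M_k preserve every set definable without parameters, so it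
   suffices that P and its complement are single orbits.  After rescaling by k,
   an automorphism is obtained by shifting integer parts by n and moving
   fractional parts by the Moebius map x |-> c x / (c x + 1 - x) of [0, 1[; it
   commutes with all integer translations, hence with t |-> t + 1.  A suitable
   choice of n and c takes any given point to any other one that is not
   separated from it by P. *)
Require Import Defs.
From mathcomp Require Import all_boot all_order all_algebra.
From mathcomp Require Import all_classical reals.
From mathcomp Require Import ring lra.

Set Implicit Arguments.
Unset Strict Implicit.
Unset Printing Implicit Defensive.

Import Order.TTheory GRing.Theory Num.Theory.

Local Open Scope classical_set_scope.
Local Open Scope ring_scope.

(** * Automorphisms of a structure and invariance of satisfaction *)

Record automorphism (M : structure) (f g : M -> M) : Prop := Automorphism {
  aut_funK : cancel f g;
  aut_invK : cancel g f;
  aut_lt : forall a b, ltI a b <-> ltI (f a) (f b);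
  aut_B : forall a b, BI a b <-> BI (f a) (f b);
  aut_P : forall a, PI a <-> PI (f a)
}.

(* With f = id this also says that satisfaction depends only on the values of
   the free variables. *)
Lemma sat_automorphism (M : structure) (f g : M -> M) (phi : formula) :
  automorphism f g -> forall e e' E E',
  (forall x, x \in free1 phi -> e' x = f (e x)) ->
  (forall X, X \in free2 phi -> forall a, E X a <-> E' X (f a)) ->
  sat e E phi <-> sat e' E' phi.
Proof.
move=> [fK gK flt fB fP].
have upd1 psi x e e' a : (forall y, y \in [seq s <- free1 psi | s != x] ->
      e' y = f (e y)) ->
    forall y, y \in free1 psi -> upd e' x (f a) y = f (upd e x a y).
  move=> he y hy; rewrite /upd; case: (eqVneq y x) => // yx.
  by apply: he; rewrite mem_filter yx.
have upd2 psi X E E' (A A' : set M) :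
    (forall Y, Y \in [seq Z <- free2 psi | Z != X] ->
      forall a, E Y a <-> E' Y (f a)) ->
    (forall a, A a <-> A' (f a)) ->
    forall Y, Y \in free2 psi -> forall a, upd E X A Y a <-> upd E' X A' Y (f a).
  move=> hE hA Y hY; rewrite /upd; case: (eqVneq Y X) => // YX.
  by apply: hE; rewrite mem_filter YX.
have split_cat (s s' : seq nat) (Q : nat -> Prop) :
    (forall x, x \in s ++ s' -> Q x) ->
    (forall x, x \in s -> Q x) /\ (forall x, x \in s' -> Q x).
  by move=> h; split=> x hx; apply: h; rewrite mem_cat hx ?orbT.
(* Set quantifiers are handled by transporting subsets: [A] on the source side corresponds to its
   image under [f], written as a preimage under the inverse [g]. *)
have preimK (A : set M) a : A a <-> (g @^-1` A) (f a) by rewrite /= fK.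
elim: phi => /= [t s|t s|t s|t|X t| | |p IHp|p IHp q IHq|p IHp q IHq|p IHp q IHq
    |t p IHp|t p IHp|X p IHp|X p IHp] e e' E E' he hE //.
- by rewrite !he ?inE ?eqxx ?orbT.
- rewrite !he ?inE ?eqxx ?orbT //.
  by split=> [->|/(can_inj fK)].
- by rewrite !he ?inE ?eqxx ?orbT.
- by rewrite !he ?inE ?eqxx.
- by rewrite he ?inE ?eqxx //; apply: hE; rewrite inE.
- by have := IHp e e' E E' he hE; tauto.
- move/split_cat: he => [hep heq]; move/split_cat: hE => [hEp hEq].
  by have := IHp _ _ _ _ hep hEp; have := IHq _ _ _ _ heq hEq; tauto.
- move/split_cat: he => [hep heq]; move/split_cat: hE => [hEp hEq].
  by have := IHp _ _ _ _ hep hEp; have := IHq _ _ _ _ heq hEq; tauto.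
- move/split_cat: he => [hep heq]; move/split_cat: hE => [hEp hEq].
  by have := IHp _ _ _ _ hep hEp; have := IHq _ _ _ _ heq hEq; tauto.
- have IH a := IHp _ _ _ _ (upd1 _ _ _ _ a he) hE.
  split=> h a; last exact/IH.
  by rewrite -(gK a); apply/IH.
- have IH a := IHp _ _ _ _ (upd1 _ _ _ _ a he) hE.
  split=> -[a]; first by move/IH; exists (f a).
  by rewrite -(gK a) => /IH; exists (g a).
- have IH A A' hA := IHp _ _ _ _ he (upd2 _ _ _ _ A A' hE hA).
  split=> h A; first exact/(IH (f @^-1` A)).
  exact/(IH _ _ (preimK A)).
- have IH A A' hA := IHp _ _ _ _ he (upd2 _ _ _ _ A A' hE hA).
  split=> -[A]; first by move/(IH _ _ (preimK A)); exists (g @^-1` A).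
  by move/(IH (f @^-1` A) A (fun=> iff_refl _)); exists (f @^-1` A).
Qed.

(** * Increasing bijections of the line that commute with integer translations *)

Section Shift.
Variable R : realType.
Implicit Types (c x y u v : R) (n : int).

(** In terms of the odds [x / (1 - x)] this is multiplication by [c]; hence [c^-1] gives the inverse
    map, and the interior of the unit interval is one orbit. *)
Definition mobius c x : R := c * x / (c * x + 1 - x).

Lemma mobius_den_gt0 c x : 0 < c -> 0 <= x < 1 -> 0 < c * x + 1 - x.
Proof.
move=> c0 /andP[x0 x1]; have := mulr_ge0 (ltW c0) x0; lra.
Qed.

Lemma mobius_itv c x : 0 < c -> 0 <= x < 1 -> 0 <= mobius c x < 1.
Proof.
move=> c0 hx; have d0 := mobius_den_gt0 c0 hx; move: hx => /andP[x0 x1].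
rewrite divr_ge0 ?(mulr_ge0 (ltW c0)) ?(ltW d0) //= ltr_pdivrMr // mul1r.
lra.
Qed.

Lemma mobiusK c x : 0 < c -> 0 <= x < 1 -> mobius c^-1 (mobius c x) = x.
Proof.
move=> c0 hx; have d0 := mobius_den_gt0 c0 hx; rewrite /mobius.
have cN0 := lt0r_neq0 c0; have dN0 := lt0r_neq0 d0.
field; rewrite cN0 dN0 /=.
(* Once cleared of fractions, the denominator of the outer [mobius] collapses to 1. *)
by rewrite (_ : _ + _ - _ = 1) ?oner_neq0 //; ring.
Qed.

Lemma mobius_lt c x y : 0 < c -> 0 <= x -> x < y -> y < 1 ->
  mobius c x < mobius c y.
Proof.
move=> c0 x0 xy y1.
have dx := @mobius_den_gt0 c x c0 _; have dy := @mobius_den_gt0 c y c0 _.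
rewrite ltr_pdivrMr ?dx //; last lra.
rewrite mulrAC ltr_pdivlMr ?dy //; last lra.
rewrite -subr_gt0.
have -> : c * y * (c * x + 1 - x) - c * x * (c * y + 1 - y) = c * (y - x).
  by ring.
by rewrite mulr_gt0 ?subr_gt0.
Qed.

Lemma mobius_trans x y : 0 < x < 1 -> 0 < y < 1 ->
  exists2 c, 0 < c & mobius c x = y.
Proof.
move=> /andP[x0 x1] /andP[y0 y1].
(* The quotient of the odds of [y] by the odds of [x]. *)
exists (y * (1 - x) / (x * (1 - y))).
  by rewrite divr_gt0 ?mulr_gt0 ?subr_gt0.
rewrite /mobius; field; rewrite (lt0r_neq0 x0) subr_eq0 (gt_eqF y1) /=.
by rewrite (_ : _ + _ + _ = 1 - x) ?subr_eq0 ?(gt_eqF x1) //; ring.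
Qed.

Definition frac u : R := u - (Num.floor u)%:~R.

Definition shift n c u : R := (Num.floor u + n)%:~R + mobius c (frac u).

Lemma frac_itv u : 0 <= frac u < 1.
Proof.
have := floor_itv u; rewrite /frac intrD => /andP[u0 u1].
by apply/andP; split; lra.
Qed.

(** Since [mobius] preserves [0, 1[, [shift] is defined as a sum of this form, so its floor and
    fractional part can be read off. *)
Lemma floor_frac_uniq n x : 0 <= x < 1 ->
  Num.floor (n%:~R + x) = n /\ frac (n%:~R + x) = x.
Proof.
move=> /andP[x0 x1]; rewrite /frac.
have -> : Num.floor (n%:~R + x) = n.
  by apply: floor_def; rewrite intrD; apply/andP; split; lra.
by split=> //; ring.
Qed.

Lemma floor_shift n c u : 0 < c -> Num.floor (shift n c u) = Num.floor u + n.
Proof.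
by move=> c0; have [] := floor_frac_uniq (Num.floor u + n) (mobius_itv c0 (frac_itv u)).
Qed.

Lemma frac_shift n c u : 0 < c -> frac (shift n c u) = mobius c (frac u).
Proof.
by move=> c0; have [] := floor_frac_uniq (Num.floor u + n) (mobius_itv c0 (frac_itv u)).
Qed.

Lemma shiftK n c : 0 < c -> cancel (shift n c) (shift (- n) c^-1).
Proof.
move=> c0 u; rewrite {1}/shift floor_shift // frac_shift // mobiusK ?frac_itv //.
by rewrite addrK /frac; ring.
Qed.

Lemma shift_lt n c : 0 < c -> {homo shift n c : u v / u < v}.
Proof.
move=> c0 u v uv; have := le_floor (ltW uv).
rewrite le_eqVlt => /orP[/eqP fE|].
  rewrite /shift fE ltrD2l; apply: mobius_lt => //.
  - by have /andP[] := frac_itv u.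
  - by rewrite /frac fE ltrD2r.
  - by have /andP[] := frac_itv v.
(* When the floors differ, the floors of the images differ in the same order, and monotonicity of
   the floor excludes the reverse order of the images. *)
rewrite -(ltrD2r n) -(floor_shift n u c0) -(floor_shift n v c0) => h.
by rewrite ltNge; apply/negP => /le_floor; rewrite leNgt h.
Qed.

Lemma shiftDz n c u m : shift n c (u + m%:~R) = shift n c u + m%:~R.
Proof.
rewrite /shift /frac floorDrz ?intr_int // intrKfloor !intrD.
rewrite (_ : u + _ - _ = u - (Num.floor u)%:~R); ring.
Qed.

(** The numerator [c * x] of [mobius] vanishes only at 0 and its denominator is positive, so
    integers and non-integers are not mixed. *)
Lemma shift_frac_eq0 n c u : 0 < c -> (frac u == 0) = (frac (shift n c u) == 0).
Proof.
move=> c0; rewrite frac_shift // /mobius mulf_eq0 invr_eq0 mulf_eq0.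
rewrite (gt_eqF (mobius_den_gt0 c0 (frac_itv u))).
by rewrite (gt_eqF c0) orbF.
Qed.

Lemma shift_trans u v : (frac u == 0) = (frac v == 0) ->
  exists n, exists2 c, 0 < c & shift n c u = v.
Proof.
move=> uv; exists (Num.floor v - Num.floor u).
suff [c c0 hc] : exists2 c, 0 < c & mobius c (frac u) = frac v.
  by exists c => //; rewrite /shift hc (addrC (Num.floor u)) subrK /frac; ring.
have /andP[u0 u1] := frac_itv u; have /andP[v0 v1] := frac_itv v.
case: (eqVneq (frac u) 0) uv => [-> /esym/eqP -> | uN0 /esym/negbT vN0].
  (* Every [mobius c] fixes 0, so 1 is an arbitrary positive choice. *)
  by exists 1 => //; rewrite /mobius mulr0 mul0r.
by apply: mobius_trans; rewrite lt0r ?uN0 ?vN0 ?u0 ?u1 ?v0 ?v1.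
Qed.

End Shift.

(** * Rescaling by [k]: automorphisms of [Mk R k] and their orbits *)

Section MkAutomorphisms.
Variables (R : realType) (k : int).
Hypothesis k_gt0 : 0 < k.
Let K : R := k%:~R.

Let K_gt0 : 0 < K. Proof. by rewrite ltr0z. Qed.
Let K_neq0 : K != 0. Proof. exact: lt0r_neq0. Qed.

Lemma PsetE t : Pset R k t <-> frac (t * K) = 0.
Proof.
split=> [[m ->]|/subr0_eq h]; last by exists (Num.floor (t * K)); rewrite -h mulfK.
by rewrite divfK // /frac intrKfloor subrr.
Qed.

Definition aut n c (t : R) : R := shift n c (t * K) / K.

Lemma autK n c : 0 < c -> cancel (aut n c) (aut (- n) c^-1).
Proof. by move=> c0 t; rewrite /aut divfK // shiftK // mulfK. Qed.

Lemma aut_automorphism n c : 0 < c ->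
  @automorphism (Mk R k) (aut n c) (aut (- n) c^-1).
Proof.
move=> c0; have fK := @autK n c c0.
have ci0 : 0 < c^-1 by rewrite invr_gt0.
have gK : cancel (aut (- n) c^-1) (aut n c).
  by have := @autK (- n) _ ci0; rewrite opprK invrK.
(* Stated for all parameters so that it also covers the inverse map, which yields the converse
   implication for the order. *)
have homo m d : 0 < d -> {homo aut m d : t s / t < s}.
  move=> d0 t s ts; rewrite /aut ltr_pM2r ?invr_gt0 // shift_lt //.
  by rewrite ltr_pM2r.
split=> //= [t s|t s|t].
- split; first exact: homo.
  by move/(homo (- n) _ ci0); rewrite !fK.
- have autS : aut n c (t + 1) = aut n c t + 1.
    (* After scaling, the unit translation becomes translation by the integer [k], with which
       [shift] commutes. *)
    by rewrite /aut [X in shift _ _ X]mulrDl mul1r shiftDz mulrDl divff.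
  by rewrite -autS; split=> [->|/(can_inj fK)].
- rewrite !PsetE /aut divfK //; split=> /eqP h; apply/eqP.
    by rewrite -shift_frac_eq0.
  by rewrite (shift_frac_eq0 n _ c0).
Qed.

Lemma Mk_orbit a b : (Pset R k a <-> Pset R k b) ->
  exists f g : R -> R, @automorphism (Mk R k) f g /\ f a = b.
Proof.
rewrite !PsetE => ab.
have [|n [c c0 h]] := @shift_trans R (a * K) (b * K).
  by apply/eqP/eqP; tauto.
exists (aut n c), (aut (- n) c^-1); split; first exact: aut_automorphism.
by rewrite /aut h mulfK.
Qed.

End MkAutomorphisms.

(** * From orbits to the four formulas *)

Lemma upd_same (T : Type) (e : nat -> T) x a : upd e x a x = a.
Proof. by rewrite /upd eqxx. Qed.

Lemma truth_set_equiv (M : structure) (phi psi : formula) (t0 : nat) :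
  equiv_in M phi psi -> truth_set M phi t0 = truth_set M psi t0.
Proof.
by move=> h; apply/seteqP; split=> t /= ht e E; apply/h.
Qed.

Theorem theorem4p2 (R : realType) (phi : formula) (t0 : nat)
    (hfree1 : free1 phi =i [:: t0]) (hfree2 : free2 phi = [::])
    (k : int) (hk : 0 < k) :
  [\/ equiv_in (Mk R k) phi FTrue,
      equiv_in (Mk R k) phi FFalse,
      equiv_in (Mk R k) phi (FP t0)
    | equiv_in (Mk R k) phi (FNot (FP t0))] /\
  [\/ truth_set (Mk R k) phi t0 = [set: R],
      truth_set (Mk R k) phi t0 = set0,
      truth_set (Mk R k) phi t0 = Pset R k
    | truth_set (Mk R k) phi t0 = ~` Pset R k].
Proof.
pose M := Mk R k.
have TT : truth_set M FTrue t0 = [set: R] by apply/seteqP; split.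
have TF : truth_set M FFalse t0 = set0.
  by apply/seteqP; split=> // t /(_ (fun=> 0) (fun=> set0)).
have TP : truth_set M (FP t0) t0 = Pset R k.
  apply/seteqP; split=> t /= h; last by move=> e E /=; rewrite upd_same.
  by have /= := h (fun=> 0) (fun=> set0); rewrite upd_same.
have TN : truth_set M (FNot (FP t0)) t0 = ~` Pset R k.
  apply/seteqP; split=> t /= h; last by move=> e E /=; rewrite upd_same.
  by have /= := h (fun=> 0) (fun=> set0); rewrite upd_same.
suff equiv : [\/ equiv_in M phi FTrue, equiv_in M phi FFalse,
    equiv_in M phi (FP t0) | equiv_in M phi (FNot (FP t0))].
  split=> //; case: equiv => /(@truth_set_equiv _ _ _ t0) ->.
  - by apply: Or41.
  - by apply: Or42.
  - by apply: Or43.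
  - by apply: Or44.
pose S (a : R) := @sat M (fun=> a) (fun=> set0) phi.
(* Satisfaction of [phi] depends only on whether [e t0] lies in P, so one test point on each side of
   P decides it. *)
have satE (e : nat -> M) E b :
    (Pset R k (e t0) <-> Pset R k b) -> sat e E phi <-> S b.
  move=> /(Mk_orbit hk)[f [g [fg fe]]]; apply: (sat_automorphism fg).
    by move=> x; rewrite hfree1 inE => /eqP ->.
  by move=> X; rewrite hfree2.
have P0 : Pset R k 0 by exists 0; rewrite mul0r.
have [q qP] : exists q, ~ Pset R k q.
  (* Scaled by [k] this point becomes 1/2, whose floor is 0 and whose fractional part is therefore
     nonzero. *)
  exists (2^-1 / k%:~R) => /(PsetE hk).
  rewrite divfK ?intr_eq0 ?lt0r_neq0 // /frac (@floor_def _ _ 0); first lra.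
  by apply/andP; split; lra.
have sat0 e E : Pset R k (e t0) -> sat (M := M) e E phi <-> S 0.
  by move=> h; apply: satE.
have satq e E : ~ Pset R k (e t0) -> sat (M := M) e E phi <-> S q.
  by move=> h; apply: satE.
have PVN a := pselect (Pset R k a).
(* The truth values at 0, inside P, and at [q], outside P, select one of the four formulas. *)
case: (pselect (S 0)) => S0; case: (pselect (S q)) => Sq.
- by apply: Or41 => e E /=; have := sat0 e E; have := satq e E; have := PVN (e t0); tauto.
- by apply: Or43 => e E /=; have := sat0 e E; have := satq e E; have := PVN (e t0); tauto.
- by apply: Or44 => e E /=; have := sat0 e E; have := satq e E; have := PVN (e t0); tauto.
- by apply: Or42 => e E /=; have := sat0 e E; have := satq e E; have := PVN (e t0); tauto.
Qed.
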